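(* Let $(X,d)$ be a uniquely geodesic space and let $A$ be a convex set in $X$. Then the following statements are equivalent: (i) $A$ is strongly convex; (ii) every local geodesic in $A$ is a geodesic; (iii) $A$ has the betweenness property.
   Context: Let $(X,d)$ be a metric space. A geodesic joining $x,y\in X$ is a mapping $\gamma:[0,l]\subseteq\mathbb{R}\to X$ with $\gamma(0)=x$, $\gamma(l)=y$ and $d(\gamma(s),\gamma(t))=|s-t|$ for all $s,t\in[0,l]$ (so $l=d(x,y)$). The image of a geodesic is called a geodesic segment. $X$ is uniquely geodesic if every two points of $X$ are joined by a unique geodesic; the geodesic segment joining $x$ and $y$ is then denoted by $[x,y]$. A local geodesic is a mapping $\gamma:[0,l]\subseteq\mathbb{R}\to X$ such that for every $t\in[0,l]$ there is a nontrivial closed interval $I$ containing $t$ in its interior such that $\gamma|_{I\cap[0,l]}$ is a geodesic (i.e. $d(\gamma(s),\gamma(s'))=|s-s'|$ for all $s,s'\in I\cap[0,l]$). A local geodesic in $A$ is one whose image is contained in $A$. A set $A\subseteq X$ is convex if $[x,y]\subseteq A$ for all $x,y\in A$. It is strongly convex if for every $x,y\in A$ the geodesic segment $[x,y]$ is contained in $A$ and there is no other local geodesic in $A$ joining $x$ and $y$ (other than the geodesic from $x$ to $y$). A set $A\subseteq X$ satisfies the betweenness property if for every four pairwise distinct points $x,y,z,w\in A$, if $y\in[x,z]$ and $z\in[y,w]$, then $y,z\in[x,w]$. *)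

(* Defs.v *)
From HB Require Import structures.
From mathcomp Require Import all_boot all_order all_algebra.
From mathcomp Require Import all_classical all_reals all_analysis.

Set Implicit Arguments.
Unset Strict Implicit.
Unset Printing Implicit Defensive.

Import Order.TTheory GRing.Theory Num.Theory.

Local Open Scope classical_set_scope.
Local Open Scope ring_scope.

Section Geodesics.
Context {R : realType} {X : metricType R}.
Implicit Types (l s t u a b : R) (g : R -> X) (x y z w : X) (A : set X).

(* A mapping [0, l] -> X is encoded by its length l and a total function
   g : R -> X, the values of which outside [0, l] are irrelevant. *)

Definition is_geodesic l g :=
  0 <= l /\ {in `[0, l] &, forall s t, mdist (g s) (g t) = `|s - t|}.

Definition is_local_geodesic l g :=
  0 <= l /\
  forall t : R, t \in `[0, l] -> exists a b : R, a < t < b /\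
    forall s u : R, s \in `[a, b] -> s \in `[0, l] ->
                    u \in `[a, b] -> u \in `[0, l] ->
      mdist (g s) (g u) = `|s - u|.

Definition joins l g x y := g 0 = x /\ g l = y.

Definition path_in A l g := {in `[0, l], forall t, A (g t)}.

(* Equality of (l1, g1) and (l2, g2) as mappings [0, l1] -> X, [0, l2] -> X. *)
Definition same_path l1 g1 l2 g2 := l1 = l2 /\ {in `[0, l1], g1 =1 g2}.

Definition uniquely_geodesic :=
  forall x y,
    (exists l g, is_geodesic l g /\ joins l g x y) /\
    (forall l1 g1 l2 g2,
      is_geodesic l1 g1 -> joins l1 g1 x y ->
      is_geodesic l2 g2 -> joins l2 g2 x y -> same_path l1 g1 l2 g2).

(* [x, y]: the union of the images of the geodesics from x to y, hence the
   image of the geodesic from x to y when the latter is unique. *)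
Definition geodesic_segment x y : set X :=
  [set p | exists l g, [/\ is_geodesic l g, joins l g x y &
                           exists2 t : R, t \in `[0, l] & g t = p]].

Definition geodesically_convex A :=
  forall x y, A x -> A y -> geodesic_segment x y `<=` A.

Definition strongly_convex A :=
  forall x y, A x -> A y ->
    geodesic_segment x y `<=` A /\
    (forall l g l0 g0,
      is_local_geodesic l g -> path_in A l g -> joins l g x y ->
      is_geodesic l0 g0 -> joins l0 g0 x y -> same_path l g l0 g0).

Definition local_geodesics_are_geodesics A :=
  forall l g, is_local_geodesic l g -> path_in A l g -> is_geodesic l g.

Definition betweenness A :=
  forall x y z w, A x -> A y -> A z -> A w -> uniq [:: x; y; z; w] ->
    geodesic_segment x z y -> geodesic_segment y w z ->
    geodesic_segment x w y /\ geodesic_segment x w z.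

End Geodesics.

Arguments uniquely_geodesic {R} X.

(* Main.v *)
Require Import Defs.
From mathcomp Require Import all_boot all_order all_algebra.
From mathcomp Require Import all_classical all_reals all_analysis.
From mathcomp Require Import lra.

(* The substance is betweenness => every local geodesic in [A] is a geodesic.
   Let [T] be the supremum of the [t] such that [g] is a geodesic on [0, t].
   Near [T], the path is a geodesic on some [a, b] overlapping such a [0, t], and
   betweenness, applied to points [s < a < t < u], glues both intervals together.
   Betweenness requires [g s <> g u]; when [g s = g u], moving [u] back to
   the midpoint [v] of [t, u] gives [d (g s) (g v) = v - s > u - v = d (g v) (g u)],
   a contradiction. *)

Import Order.TTheory GRing.Theory Num.Theory.
Local Open Scope classical_set_scope.
Local Open Scope ring_scope.

(** The interval may start anywhere and may be empty, so that [g] can be restricted without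
    reparametrizing it. *)
Definition geodesic_on {R : realType} {X : metricType R} (a b : R)
    (g : R -> X) :=
  {in `[a, b] &, forall s t, mdist (g s) (g t) = `|s - t|}.

Section Geodesics.
Context {R : realType} {X : metricType R}.
Implicit Types (a b c l s t u : R) (g : R -> X) (x y z w : X) (A : set X).

Lemma geodesic_onP a b g :
  (forall s u, a <= s -> s < u -> u <= b -> mdist (g s) (g u) = u - s) ->
  geodesic_on a b g.
Proof.
move=> H s u; rewrite !in_itv /= => /andP[as_ sb] /andP[au ub].
have [su|us|->] := ltgtP s u; last by rewrite mdistxx subrr normr0.
- by rewrite H// distrC ger0_norm// subr_ge0 ltW.
- by rewrite metric_sym H// ger0_norm// subr_ge0 ltW.
Qed.

Lemma geodesic_on_dist {a b g} s u : geodesic_on a b g ->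
  a <= s -> s <= u -> u <= b -> mdist (g s) (g u) = u - s.
Proof.
move=> H as_ su ub; rewrite H ?in_itv/= ?as_ ?ub ?andbT/=; [|lra..].
by rewrite distrC ger0_norm// subr_ge0.
Qed.

Lemma geodesic_on_shift a b g : a <= b -> geodesic_on a b g ->
  is_geodesic (b - a) (fun t => g (a + t)).
Proof.
move=> ab H; split; first by rewrite subr_ge0.
apply: geodesic_onP => s u s0 su ub.
by rewrite (geodesic_on_dist _ _ H); lra.
Qed.

Lemma geodesic_on_segment a b c g : geodesic_on a b g -> a <= c -> c <= b ->
  geodesic_segment (g a) (g b) (g c).
Proof.
move=> H ac cb; exists (b - a), (fun t => g (a + t)); split.
- by apply: geodesic_on_shift => //; lra.
- by split; congr (g _); lra.
- by exists (c - a); [rewrite in_itv/=; lra|congr (g _); lra].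
Qed.

Lemma geodesic_segment_dist x y p : geodesic_segment x y p ->
  mdist x y = mdist x p + mdist p y.
Proof.
move=> [l] [g] [[l0 H] [<- <-]] [t]; rewrite in_itv/= => /andP[t0 tl] <-.
by rewrite !(geodesic_on_dist _ _ H)//; lra.
Qed.

(** Clipping with [max] and [min] keeps [a < t < b] strict even when [t] is an endpoint of
    [[0, l]]. *)
Lemma local_geodesic_geodesic_on {l g t} : is_local_geodesic l g ->
  0 <= t -> t <= l -> exists a b, a < t < b /\
    geodesic_on (Num.max a 0) (Num.min b l) g.
Proof.
move=> [_ H] t0 tl; have [|a [b [atb ab]]] := H t; first by rewrite in_itv/= t0.
exists a, b; split=> // s u; rewrite !in_itv/= !ge_max !le_min.
move=> /andP[/andP[? ?] /andP[? ?]] /andP[/andP[? ?] /andP[? ?]].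
by apply: ab; rewrite in_itv/=; apply/andP.
Qed.

Lemma betweenness_glue {A} {a b c d : R} {g} : betweenness A ->
  (forall t, a <= t <= d -> A (g t)) ->
  b < c -> geodesic_on a c g -> geodesic_on b d g -> geodesic_on a d g.
Proof.
move=> btw gA bc gac gbd; apply: geodesic_onP => s u as_ su ud.
have [uc|cu] := leP u c; first by apply: (geodesic_on_dist _ _ gac) => //; lra.
have [bs|sb] := leP b s; first by apply: (geodesic_on_dist _ _ gbd) => //; lra.
(* What remains is [s < b < c < u]. The claim is stated for every [v] in [(c, u]], since it is
   applied at [u] or at an earlier point. *)
have key v : c < v -> v <= u -> g s <> g v -> mdist (g s) (g v) = v - s.
  move=> cv vu sv.
  have neq_of_dist p q : 0 < mdist (g p) (g q) -> g p != g q.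
    by rewrite mdist_gt0.
  have gs c' : s <= c' -> c' <= c -> mdist (g s) (g c') = c' - s.
    by move=> *; apply: (geodesic_on_dist _ _ gac); lra.
  have gv p q : b <= p -> p <= q -> q <= v -> mdist (g p) (g q) = q - p.
    by move=> *; apply: (geodesic_on_dist _ _ gbd); lra.
  have /= := btw (g s) (g b) (g c) (g v).
  case.
  - by apply: gA; lra.
  - by apply: gA; lra.
  - by apply: gA; lra.
  - by apply: gA; lra.
  - rewrite !inE !negb_or !andbT; move/eqP: sv => ->; rewrite andbT.
    by rewrite !neq_of_dist ?gs ?gv//; lra.
  - apply: geodesic_on_segment; [|lra..].
    apply: geodesic_onP => p q *; apply: (geodesic_on_dist _ _ gac); lra.
  - apply: geodesic_on_segment; [|lra..].
    by apply: geodesic_onP => p q *; apply: gv; lra.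
  (* As [g c] lies between [g s] and [g v], the distance is [(c - s) + (v - c)]. *)
  - by move=> _ /geodesic_segment_dist ->; rewrite gs ?gv; lra.
have [su_eq|] := pselect (g s = g u); last by apply: key => //; lra.
pose v := (c + u) / 2.
have dvu : mdist (g v) (g u) = u - v.
  by apply: (geodesic_on_dist _ _ gbd); rewrite /v; lra.
have dsv : mdist (g s) (g v) = v - s.
  (* If [g s = g v], then [g v = g u], against [dvu] and [v < u]. *)
  apply: key; rewrite /v; [lra..|move=> svE].
  by move: dvu; rewrite /v -svE su_eq mdistxx; lra.
by move: dsv; rewrite su_eq metric_sym dvu /v; lra.
Qed.

Lemma betweenness_local_geodesics A :
  betweenness A -> local_geodesics_are_geodesics A.
Proof.
move=> btw l g lg gA; have l0 := lg.1; split=> //.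
pose S := [set t : R | 0 <= t <= l /\ geodesic_on 0 t g].
have S0 : S 0.
  by split; [rewrite lexx|apply: geodesic_onP => s u *; lra].
have Sub : has_ubound S by exists l => t [/andP[]].
have T0 : 0 <= sup S by apply: ub_le_sup.
have Tl : sup S <= l by apply: ge_sup; [exists 0|move=> t [/andP[]]].
have [a [b [/andP[aT Tb] gab]]] := local_geodesic_geodesic_on lg T0 Tl.
have [t [/andP[t0 tl] gt]] : exists2 t, S t & a < t.
  have [|t St] := @sup_adherent _ S (sup S - a) _ (conj (ex_intro _ 0 S0) Sub).
    by rewrite subr_gt0.
  by rewrite subKr; exists t.
move=> a_t.
have gb : geodesic_on 0 (Num.min b l) g.
  (* For [a <= 0] the interval around [sup S] already reaches back to [0], and nothing has to be
     glued. *)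
  have [a0|a0] := leP a 0; first by move: gab; rewrite (max_idPr a0).
  move: gab; rewrite (max_idPl (ltW a0)) => gab.
  apply: (betweenness_glue btw _ a_t gt gab) => r.
  rewrite le_min => /and3P[r0 _ rl].
  by apply: gA; rewrite in_itv/= r0.
(* Since [sup S < b], this bound forces [l <= sup S < b]; then [min b l = l] and [gb] is the
   goal. *)
have : Num.min b l <= sup S.
  apply: ub_le_sup => //; split=> //; rewrite ge_min lexx orbT andbT le_min l0.
  by rewrite andbT; lra.
by rewrite ge_min leNgt Tb/= => lT; move: gb; rewrite (min_idPr _)//; lra.
Qed.

(** Follow [[x, z]] and continue along [[y, w]]. By uniqueness both geodesics run through the same
    [[y, z]], which is nontrivial as [y != z]. The concatenation is therefore a local geodesic,
    hence a geodesic from [x] to [w] through [y] and [z]. *)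
Lemma local_geodesics_betweenness A : uniquely_geodesic X ->
  geodesically_convex A -> local_geodesics_are_geodesics A -> betweenness A.
Proof.
move=> hX hA lgA x y z w Ax Ay Az Aw uxyzw sxzy syzw.
have [l1 [g1 [G1 J1 [t1 t1l g1y]]]] := sxzy.
have [l2 [g2 [G2 J2 [t2 t2l g2z]]]] := syzw.
move: t1l t2l; rewrite !in_itv/= => /andP[t10 t1l] /andP[t20 t2l].
case: (J1) => g10 g1l; case: (J2) => g20 g2l.
have dyz1 : mdist y z = l1 - t1.
  by rewrite -g1y -g1l; apply: (geodesic_on_dist _ _ G1.2).
have dyz2 : mdist y z = t2.
  by rewrite -g2z -g20 (geodesic_on_dist _ _ G2.2)// subr0.
have yz : y != z by move: uxyzw => /=; rewrite !inE !negb_or; case/and4P => _ /andP[].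
have t2_gt0 : 0 < t2 by rewrite -dyz2 mdist_gt0.
have agree r : t1 <= r -> r <= l1 -> g1 r = g2 (r - t1).
  move=> t1r rl1.
  have := (hX y z).2 (l1 - t1) (fun r => g1 (t1 + r)) t2 g2.
  case.
  - apply: geodesic_on_shift => // s u su_ ut; apply: G1.2; move: su_ ut;
    rewrite !in_itv/=; lra.
  - by split; rewrite /= ?addr0 ?subrKC.
  - by split=> // s u su_ ut; apply: G2.2; move: su_ ut; rewrite !in_itv/=; lra.
  - by [].
  - move=> _ /(_ (r - t1)); rewrite subrKC; apply.
    by rewrite in_itv/=; lra.
pose g r := if r <= l1 then g1 r else g2 (r - t1).
(* The clock of [g2] starts at time [t1], when [g1] passes through [y]. *)
pose l := t1 + l2.
have g1E r : r <= l1 -> g r = g1 r by rewrite /g => ->.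
have g2E r : t1 <= r -> g r = g2 (r - t1).
  by move=> t1r; rewrite /g; case: leP => // rl1; rewrite agree.
have gG1 : geodesic_on 0 l1 g.
  apply: geodesic_onP => s u *; rewrite !g1E; [|lra..].
  by apply: (geodesic_on_dist _ _ G1.2); lra.
have gG2 : geodesic_on t1 l g.
  apply: geodesic_onP => s u t1s su ul; rewrite !g2E; [|lra..].
  by rewrite (geodesic_on_dist _ _ G2.2); move: ul; rewrite /l; lra.
have gA : path_in A l g.
  move=> r; rewrite in_itv/= => /andP[r0 rl]; have [rl1|l1r] := leP r l1.
  - apply: (hA x z) => //; rewrite g1E//; exists l1, g1; split=> //.
    by exists r => //; rewrite in_itv/= r0.
  - apply: (hA y w) => //; rewrite g2E; last lra.
    exists l2, g2; split=> //; exists (r - t1) => //.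
    by rewrite in_itv/=; move: rl; rewrite /l; lra.
have lg : is_local_geodesic l g.
  split; first by rewrite /l; lra.
  (* Because [t1 < l1], each [t] is interior to one of the two pieces, up to the ends of [[0, l]];
     the margin [1] only extends past those ends or into the same piece. *)
  move=> t; rewrite in_itv/= => /andP[t0 tl]; have [tl1|l1t] := ltP t l1.
  - exists (t - 1), l1; split; first lra.
    by move=> s u; rewrite !in_itv/= => *; apply: gG1; rewrite in_itv/=; lra.
  - exists t1, (t + 1); split; first lra.
    by move=> s u; rewrite !in_itv/= => *; apply: gG2; rewrite in_itv/=; lra.
have [_ G] := lgA _ _ lg gA.
have g0 : g 0 = x by rewrite g1E//; lra.
have gl : g l = w by rewrite g2E /l; [rewrite addrC addKr|lra].
have gt1 : g t1 = y by rewrite g1E.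
have gl1 : g l1 = z by rewrite g1E.
rewrite -g0 -gl -{1}gt1 -gl1; split; apply: geodesic_on_segment => //.
all: rewrite /l; lra.
Qed.

(** The endpoints of a local geodesic are joined by some geodesic, and strong convexity identifies
    the two paths. *)
Lemma strongly_convex_local_geodesics A : uniquely_geodesic X ->
  strongly_convex A -> local_geodesics_are_geodesics A.
Proof.
move=> hX scA l g lg gA; have l0 := lg.1; split=> //.
have [A0 Al] : A (g 0) /\ A (g l) by split; apply: gA; rewrite in_itv/= lexx ?l0.
have [[l' [g' [G' J']]] _] := hX (g 0) (g l).
have [ll' gg'] := (scA _ _ A0 Al).2 l g l' g' lg gA (conj erefl erefl) G' J'.
by move=> s t sl tl; rewrite !gg'//; apply: G'.2; rewrite -ll'.
Qed.

Lemma local_geodesics_strongly_convex A : uniquely_geodesic X ->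
  geodesically_convex A -> local_geodesics_are_geodesics A ->
  strongly_convex A.
Proof.
move=> hX hA lgA x y Ax Ay; split; first exact: hA.
move=> l g l' g' lg gA J; apply: (hX x y).2 => //; exact: lgA.
Qed.

End Geodesics.

Theorem proposition2p4 (R : realType) (X : metricType R) (A : set X)
    (hX : uniquely_geodesic X) (hA : geodesically_convex A) :
  (strongly_convex A <-> local_geodesics_are_geodesics A) /\
  (local_geodesics_are_geodesics A <-> betweenness A).
Proof.
split; split.
- exact: strongly_convex_local_geodesics.
- exact: local_geodesics_strongly_convex.
- exact: local_geodesics_betweenness.
- exact: betweenness_local_geodesics.
Qed.
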